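(* Let $S$ be a numerical semigroup, and let $g$ be a gap of $S$. Then $$\mathrm{r}(\{0,g\}+S)=\min\{k\in\mathbb{N}:(k+1)g\in S\}.$$
   Context: $\mathbb{N}$ denotes the non-negative integers. A numerical semigroup $S$ is a submonoid of $(\mathbb{N},+)$ with finite complement in $\mathbb{N}$; the elements of $\mathbb{N}\setminus S$ are its gaps. For a set $X$ of integers, $X+S=\{x+s: x\in X, s\in S\}$. $\mathcal{I}_0(S)=\{E\subseteq\mathbb{N}: E+S\subseteq E,\ \min(E)=0\}$ is the set of ideals of $S$ with minimum $0$; it is a monoid under $I+J=\{a+b: a\in I, b\in J\}$. For a positive integer $k$, $kI$ denotes the $k$-fold sum $I+\dots+I$. The reduction number $\mathrm{r}(I)$ of $I\in\mathcal{I}_0(S)$ is the smallest positive integer $r$ such that $(r+1)I=rI$. *)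

(* Defs.v *)
From mathcomp Require Import all_boot.
From mathcomp Require Import classical_sets cardinality.

Set Implicit Arguments.
Unset Strict Implicit.
Unset Printing Implicit Defensive.

Local Open Scope classical_set_scope.

Record numerical_semigroup (S : set nat) : Prop := NumericalSemigroup {
  ns_zero : S 0;
  ns_add : forall a b, S a -> S b -> S (a + b);
  ns_cofinite : finite_set (~` S) }.

Definition gap (S : set nat) (g : nat) : Prop := (~` S) g.

Definition sumset (X Y : set nat) : set nat := [set x + y | x in X & y in Y].

(* Minima are relational, so asserting one includes that it is attained. *)
Definition is_min (A : set nat) (m : nat) : Prop :=
  A m /\ forall n, A n -> m <= n.

Definition ideals0 (S : set nat) : set (set nat) :=
  [set E | sumset E S `<=` E /\ is_min E 0].

(* The k-fold sum I + ... + I for k > 0; the value [set 0] at k = 0 is a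
   convention that the reduction number does not use. *)
Definition nfold_sum (k : nat) (I : set nat) : set nat :=
  iterop k sumset I [set 0].

(* r(I) = r, for I in the monoid of ideals of S with minimum 0. *)
Definition is_reduction_number (S I : set nat) (r : nat) : Prop :=
  ideals0 S I /\
  is_min [set k | 0 < k /\ nfold_sum k.+1 I = nfold_sum k I] r.

(* Main.v *)
(** With I = {0, g} + S, the k-fold sum kI consists of the i g + s with i <= k
    and s in S.  So (k+1)I = kI as soon as (k+1)g is in S.  Conversely, equality
    puts (k+1)g in kI, whence (k+1-i)g is in S for some i <= k: this is a
    possibly smaller multiple, so only the minima of the two sets of exponents
    have to agree. *)

Require Import Defs.
From mathcomp Require Import all_boot.
From mathcomp Require Import boolp classical_sets cardinality.

Local Open Scope classical_set_scope.

Lemma is_min_exists (A : set nat) : A !=set0 -> exists m, is_min A m.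
Proof.
case=> n An; have exA : exists n, `[< A n >] by exists n; exact/asboolP.
case: (ex_minnP exA) => m /asboolP Am minm; exists m; split=> // k Ak.
exact/minm/asboolP.
Qed.

(** Otherwise the map [k] to [k.+1 * g], injective because [g] is positive, would send all of the
    naturals into the finite set of gaps. *)
Lemma numerical_semigroup_multiple (S : set nat) (g : nat) :
  numerical_semigroup S -> 0 < g -> exists k, S (k.+1 * g).
Proof.
move=> [_ _ finC] g_gt0; apply: contrapT => noS; apply: infinite_nat.
have -> : [set: nat] = (fun k => k.+1 * g) @^-1` (~` S).
  by apply/seteqP; split=> // k _ Sk; apply: noS; exists k.
apply: finite_preimage finC => k l _ _ /eqP.
by rewrite eqn_pmul2r // => /eqP [].
Qed.

Lemma nfold_sumS (k : nat) (I : set nat) :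
  nfold_sum k.+2 I = sumset I (nfold_sum k.+1 I).
Proof. by []. Qed.

Section TwoGeneratedIdeal.
Variables (S : set nat) (g : nat).
Hypothesis hS : numerical_semigroup S.

Lemma sumset_pairE :
  sumset [set 0; g] S = [set n | exists2 i, i <= 1 & exists2 s, S s & n = i * g + s].
Proof.
apply/seteqP; split=> n /=.
  case=> x [] -> [s Ss <-]; last by exists 1 => //; exists s; rewrite ?mul1n.
  by exists 0 => //; exists s.
case=> -[|[|//]] _ [s Ss ->].
  by exists 0; [left | exists s].
by exists g; [right | exists s; rewrite ?mul1n].
Qed.

Lemma nfold_sum_pairE (k : nat) : 0 < k ->
  nfold_sum k (sumset [set 0; g] S) =
  [set n | exists2 i, i <= k & exists2 s, S s & n = i * g + s].
Proof.
case: k => // k _; elim: k => [|k IHk]; first exact: sumset_pairE.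
rewrite nfold_sumS IHk sumset_pairE; apply/seteqP; split=> n /=.
  case=> _ [i i1 [s Ss ->]] [_ [j jk [t St ->]] <-].
  exists (i + j); first exact: (leq_add i1 jk).
  by exists (s + t); [exact: ns_add | rewrite mulnDl addnACA].
(* One summand of the ideal is split off: [0] if no copy of [g] is present, and [g] itself
   otherwise, which lowers the exponent by one. *)
case=> -[|i] ik [s Ss ->].
  exists 0; first by exists 0 => //; exists 0; [exact: ns_zero |].
  by exists s => //; exists 0 => //; exists s.
exists g; first by exists 1 => //; exists 0; [exact: ns_zero | rewrite mul1n addn0].
by exists (i * g + s); [exists i => //; exists s | rewrite mulSn addnA].
Qed.

Lemma ideals0_pair : ideals0 S (sumset [set 0; g] S).
Proof.
rewrite sumset_pairE; split; last first.
  by split=> //; exists 0 => //; exists 0; [exact: ns_zero |].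
move=> _ [_ [i i1 [s Ss ->]] [t St <-]]; exists i => //.
by exists (s + t); [exact: ns_add | rewrite addnA].
Qed.

(** Only the top exponent [i = k.+1] can give new elements, and there [k.+1 * g + s] already lies in
    [S], so it is rewritten with exponent [0]. *)
Lemma nfold_sum_stable (k : nat) : 0 < k -> S (k.+1 * g) ->
  nfold_sum k.+1 (sumset [set 0; g] S) = nfold_sum k (sumset [set 0; g] S).
Proof.
move=> k0 Sk; rewrite !nfold_sum_pairE //; apply/seteqP; split=> n /= [i ik [s Ss ->]].
  move: ik; rewrite leq_eqVlt => /predU1P[-> | ik]; last by exists i => //; exists s.
  by exists 0 => //; exists (k.+1 * g + s) => //; exact: ns_add.
by exists i; [exact: leqW | exists s].
Qed.

Lemma nfold_sum_stable_multiple (k : nat) : 0 < k ->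
  nfold_sum k.+1 (sumset [set 0; g] S) = nfold_sum k (sumset [set 0; g] S) ->
  exists2 l, l <= k & S (l.+1 * g).
Proof.
move=> k0; rewrite !nfold_sum_pairE // => /seteqP[+ _] => /(_ (k.+1 * g)).
case=> [|i ik [s Ss ks]].
  by exists k.+1 => //; exists 0; [exact: ns_zero | rewrite addn0].
(* From [k.+1 * g = i * g + s] one gets [s = (k.+1 - i) * g]; since [i <= k], this multiplier is the
   successor of [k - i]. *)
exists (k - i); first exact: leq_subr.
by rewrite -subSn // mulnBl ks addKn.
Qed.

End TwoGeneratedIdeal.

Theorem proposition4p14 (S : set nat) (g : nat)
  (hS : numerical_semigroup S) (hg : gap S g) :
  exists r : nat,
    is_reduction_number S (sumset [set 0; g] S) r /\
    is_min [set k | S (k.+1 * g)] r.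
Proof.
have g_gt0 : 0 < g.
  by rewrite lt0n; apply/eqP => g0; apply: hg; rewrite g0; exact: ns_zero.
have [r [Sr minr]] :=
  is_min_exists _ (numerical_semigroup_multiple _ _ hS g_gt0).
exists r; split=> //; split; first exact: ideals0_pair.
split=> [|k [k0 kE]].
  (* The reduction number must be positive, whereas the minimum over multiples ranges over all
     naturals; [r = 0] would put the gap [g] in [S]. *)
  have r0 : 0 < r.
    by rewrite lt0n; apply/eqP => r0; apply: hg; move: Sr; rewrite /= r0 mul1n.
  by split=> //; exact: nfold_sum_stable.
(* Minimality of [r] is applied to [l] rather than to [k], giving [r <= l <= k]. *)
have [l lk Sl] := nfold_sum_stable_multiple _ _ hS _ k0 kE.
exact: leq_trans (minr _ Sl) lk.
Qed.
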